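(* Let $\beta\in(1-\frac2n,1)$ for $n\ge2$, or $\beta\in(0,1)$ for $n=1$. Assume that $\varphi$ and $\psi$ are quasisymmetric mappings on $\mathbb R^n$, with the additional assumption that $J_\varphi,J_\psi,J_{\varphi^{-1}},J_{\psi^{-1}}\in A_\infty(\mathbb R)$ when $n=1$. If $\|\varphi\|_{\mathscr G_\beta}<\infty$ and $\|\psi\|_{\mathscr G_\beta}<\infty$, then $\|\varphi\circ\psi\|_{\mathscr G_\beta}<\infty$.
   Context: **Cubes.** All cubes in $\mathbb R^n$ have sides parallel to the coordinate axes (open, closed or half-open); $\ell(Q)$ is the side length, $|E|$ is Lebesgue measure. For a cube $Q$, $\mathcal D_0(Q)=\{Q\}$, and for $k\in\mathbb N$, $\mathcal D_k(Q)$ is the family of the $2^{kn}$ subcubes of side length $2^{-k}\ell(Q)$ obtained by $k$ successive bisections of each side of $Q$; $\mathcal D(Q)=\bigcup_{k\ge0}\mathcal D_k(Q)$. **Quasisymmetric maps.** A homeomorphism $\varphi:\mathbb R^n\to\mathbb R^n$ is quasisymmetric if there is an increasing homeomorphism $\eta:[0,\infty)\to[0,\infty)$ with $\eta(0)=0$ and $\frac{|\varphi(x)-\varphi(y)|}{|\varphi(x)-\varphi(z)|}\le\eta\left(\frac{|x-y|}{|x-z|}\right)$ for all distinct $x,y,z\in\mathbb R^n$. **Weights and Jacobians.** $A_\infty(\mathbb R)$ is the Muckenhoupt class of weights $w$ (nonnegative, locally integrable) with $\sup_Q\left(\frac1{|Q|}\int_Qw\right)\exp\left(-\frac1{|Q|}\int_Q\log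 w\right)<\infty$. $J_\varphi$ is the Jacobian of $\varphi$; an assumption $J_\varphi\in A_\infty$ is understood to include $|\varphi(E)|=\int_EJ_\varphi\,dx$ for all measurable $E$ (similarly for the other maps). **Capacity gauge.** For $\beta\in\mathbb R$, a homeomorphism $\varphi$ and a cube $Q$, let $\mathscr T_\beta(Q)$ be the set of families $\{\lambda_I\}_{I\in\mathcal D(Q)}\subset[0,\infty)$ with $$\sum_{I\in\mathcal D(Q),\,I\supset J}\lambda_I\left(\frac{|I|}{|J|}\cdot\frac{|\varphi^{-1}(J)|}{|\varphi^{-1}(I)|}\right)^\beta\ge1\quad\text{for all }J\in\mathcal D(Q),$$ $$\|\varphi\|_{\mathscr G_\beta(Q)}:=\inf_{\{\lambda_I\}\in\mathscr T_\beta(Q)}\sum_{I\in\mathcal D(Q)}\lambda_I\left(\frac{|I|}{|Q|}\right)^\beta,\qquad \|\varphi\|_{\mathscr G_\beta}:=\sup_{\text{cubes }Q\subset\mathbb R^n}\|\varphi\|_{\mathscr G_\beta(Q)}\in[0,\infty].$$ *)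

(* Defs.v *)
From HB Require Import structures.
From mathcomp Require Import all_boot all_order all_algebra.
From mathcomp Require Import all_classical all_reals all_analysis.

Set Implicit Arguments.
Unset Strict Implicit.
Unset Printing Implicit Defensive.

Import Order.TTheory GRing.Theory Num.Theory.
Import numFieldNormedType.Exports.

Local Open Scope classical_set_scope.
Local Open Scope ring_scope.

(* The two flags say whether the lower and the upper end points of all the
   sides belong to the cube; this covers open, closed and half-open cubes. *)
Record cube (R : realType) (n : nat) := Cube {
  corner : 'rV[R]_n;
  side : {posnum R};
  lower_closed : bool;
  upper_closed : bool }.

HB.instance Definition _ (R : realType) (n : nat) := gen_eqMixin (cube R n).
HB.instance Definition _ (R : realType) (n : nat) := gen_choiceMixin (cube R n).

Section Cubes.
Variables (R : realType) (n : nat).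
Implicit Types Q I J : cube R n.

Definition pts Q : set 'rV[R]_n :=
  [set x | forall i, x ord0 i \in
     Interval (BSide (lower_closed Q) (corner Q ord0 i))
              (BSide (~~ upper_closed Q) (corner Q ord0 i + (side Q)%:num))].

(* After k bisections, the subcube in position j = (j_0, ..., j_(n-1)) of the
   2^k x ... x 2^k grid; it is open, closed or half-open as Q is. *)
Definition subcube Q (k : nat) (j : {ffun 'I_n -> 'I_(2 ^ k)}) : cube R n :=
  Cube (\row_i (corner Q ord0 i + (j i)%:R * ((side Q)%:num / 2 ^+ k)))
       ((side Q)%:num / 2 ^+ k)%:pos (lower_closed Q) (upper_closed Q).

Definition dyadic_level (k : nat) Q : set (cube R n) := range (@subcube Q k).

Definition dyadic Q : set (cube R n) := \bigcup_k dyadic_level k Q.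

End Cubes.

Section LebesgueOuterMeasure.
Variables (R : realType) (n : nat).
Local Open Scope ereal_scope.

Definition cube_cover (E : set 'rV[R]_n) : set (set (cube R n)) :=
  [set F | countable F /\ E `<=` \bigcup_(Q in F) pts Q].

(* The Lebesgue (outer) measure on R^n, which the library only has on R; the
   integral on R^n is the one of the Caratheodory measure it induces. *)
Definition lebesgue (E : set 'rV[R]_n) : \bar R :=
  ereal_inf [set \esum_(Q in F) ((side Q)%:num ^+ n)%:E | F in cube_cover E].

Let vol_ge0 (Q : cube R n) : 0 <= ((side Q)%:num ^+ n)%:E.
Proof. by rewrite lee_fin exprn_ge0. Qed.

Let lebesgue_ge0 E : 0 <= lebesgue E.
Proof. by apply: le_ereal_inf_tmp => _ [F _ <-]; apply: esum_ge0. Qed.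

Let lebesgue0 : lebesgue set0 = 0.
Proof.
apply/eqP; rewrite eq_le lebesgue_ge0 andbT.
apply: ereal_inf_lbound; exists set0; last by rewrite esum_set0.
by split; [exact: countable0|exact: sub0set].
Qed.

Let le_lebesgue : {homo lebesgue : A B / A `<=` B >-> A <= B}.
Proof.
move=> A B AB; apply/ereal_inf_le_tmp => _ [F [cF BF] <-].
by exists F => //; split => //; apply: subset_trans AB BF.
Qed.

Let esum_bigcup_le (F : (set (cube R n))^nat) (a : cube R n -> \bar R) :
    (forall Q, 0 <= a Q) ->
  \esum_(Q in \bigcup_k F k) a Q <= \sum_(k <oo) \esum_(Q in F k) a Q.
Proof.
move=> a0; rewrite seqDU_bigcup_eq nneseries_sum_bigcup//.
apply: lee_nneseries => [k _ _|k _]; first exact: esum_ge0.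
rewrite (_ : seqDU F k = F k `&` seqDU F k); last first.
  by apply/esym/setIidPr; exact: subset_seqDU.
by rewrite esum_mkcondr; apply: le_esum => Q _; case: ifP.
Qed.

Let lebesgue_sigma_subadditive : sigma_subadditive lebesgue.
Proof.
move=> A; have [[i ioo]|] := pselect (exists i, lebesgue (A i) = +oo).
  rewrite (eseries_pinfty _ _ ioo) ?leey// => k _.
  by rewrite -ltNye (lt_le_trans _ (lebesgue_ge0 _)).
rewrite -forallNE => Aoo.
apply/lee_addgt0Pr => _/posnumP[e].
rewrite (le_trans _ (epsilon_trick _ _ _))//.
have [G PG] : {G : (set (cube R n))^nat & forall k, cube_cover (A k) (G k) /\
    \esum_(Q in G k) ((side Q)%:num ^+ n)%:E
      <= lebesgue (A k) + (e%:num / (2 ^ k.+1)%:R)%:E}.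
  apply: (@choice _ _ (fun k F => cube_cover (A k) F /\
    \esum_(Q in F) ((side Q)%:num ^+ n)%:E
      <= lebesgue (A k) + (e%:num / (2 ^ k.+1)%:R)%:E)) => k.
  have fA : lebesgue (A k) \is a fin_num.
    by rewrite ge0_fin_numE// ltey; apply/eqP/Aoo.
  have ek0 : (0 < e%:num / (2 ^ k.+1)%:R :> R)%R by [].
  have [_ [F cF <-] /ltW Fle] := lb_ereal_inf_adherent ek0 fA.
  by exists F.
apply: (@le_trans _ _
    (\esum_(Q in \bigcup_k G k) ((side Q)%:num ^+ n)%:E)).
  apply: ereal_inf_lbound; exists (\bigcup_k G k) => //; split.
    by apply: bigcup_countable => // k _; have [[]] := PG k.
  move=> x [k _ Akx]; have [[_ /(_ _ Akx)[Q GQ Qx]] _] := PG k.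
  by exists Q => //; exists k.
apply: le_trans (esum_bigcup_le _ vol_ge0) _.
apply: lee_nneseries => [k _ _|k _]; first exact: esum_ge0.
by have [] := PG k.
Qed.

HB.instance Definition _ := isOuterMeasure.Build R 'rV[R]_n lebesgue
  lebesgue0 lebesgue_ge0 le_lebesgue lebesgue_sigma_subadditive.

End LebesgueOuterMeasure.

Arguments lebesgue {R n} E.

Definition vol (R : realType) (n : nat) (E : set 'rV[R]_n) : R :=
  fine (lebesgue E).

Section Muckenhoupt.
Variables (R : realType) (n : nat).
Local Open Scope ereal_scope.

(* R^n with its sigma-algebra of Lebesgue measurable sets *)
Local Notation Rn := (caratheodory_type (@lebesgue R n)).
Local Notation mu := (@lebesgue R n : set Rn -> \bar R).

Definition weight (w : Rn -> R) : Prop :=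
  (forall x, (0 <= w x)%R) /\
  (forall K : set 'rV[R]_n, compact K -> mu.-integrable K (EFin \o w)).

Definition average (Q : cube R n) (f : Rn -> \bar R) : \bar R :=
  (vol (pts Q))^-1%:E * \int[mu]_(x in pts Q) f x.

(* Here log 0 = -oo, so the second factor is +oo when log w is not integrable
   on Q.  As 0 * +oo = 0, w = 0 passes this test, but J_in_A_infty below rules
   it out. *)
Definition A_infty (w : Rn -> R) : Prop :=
  weight w /\
  ereal_sup [set average Q (EFin \o w) *
                 expeR (- average Q (fun x => lne (w x)%:E))
            | Q in [set: cube R n]] < +oo.

Definition Jac (phi : 'rV[R]_n -> 'rV[R]_n) : 'rV[R]_n -> R :=
  fun x => `| \det (jacobian phi x) |%R.

Definition J_in_A_infty (phi : 'rV[R]_n -> 'rV[R]_n) : Prop :=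
  A_infty (Jac phi) /\
  (forall E : set Rn, measurable E ->
     lebesgue (phi @` E) = \int[mu]_(x in E) (Jac phi x)%:E).

End Muckenhoupt.

Section Quasisymmetric.
Variables (R : realType) (n : nat).

Definition homeomorphism (T : ptopologicalType) (U : topologicalType)
    (A : set T) (B : set U) (f : T -> U) : Prop :=
  [/\ set_bij A B f, {within A, continuous f} &
      {within B, continuous (pinv A f)}].

(* The library norm of 'rV[R]_n is the sup norm. *)
Definition enorm (x : 'rV[R]_n) : R :=
  Num.sqrt (\sum_(i < n) x ord0 i ^+ 2).

Definition quasisymmetric (phi : 'rV[R]_n -> 'rV[R]_n) : Prop :=
  homeomorphism setT setT phi /\
  exists eta : R -> R,
    [/\ @homeomorphism R R `[0, +oo[ `[0, +oo[ eta,
        {in `[0, +oo[ &, {homo eta : s t / s < t}},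
        eta 0 = 0 &
        forall x y z, x <> y -> x <> z -> y <> z ->
          enorm (phi x - phi y) / enorm (phi x - phi z)
            <= eta (enorm (x - y) / enorm (x - z))].

End Quasisymmetric.

Section Gauge.
Variables (R : realType) (n : nat) (beta : R) (phi : 'rV[R]_n -> 'rV[R]_n).
Implicit Types Q I J : cube R n.

Definition admissible Q : set (cube R n -> R) :=
  [set lambda | (forall I, dyadic Q I -> 0 <= lambda I) /\
    forall J, dyadic Q J ->
      (1 <= \esum_(I in [set I | dyadic Q I /\ pts J `<=` pts I])
        (lambda I * (vol (pts I) / vol (pts J) *
           (vol (phi @^-1` pts J) / vol (phi @^-1` pts I))) `^ beta)%:E)%E].

Definition gauge_at Q : \bar R :=
  ereal_inf [set \esum_(I in dyadic Q)
                   (lambda I * (vol (pts I) / vol (pts Q)) `^ beta)%:E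
            | lambda in admissible Q].

Definition gauge : \bar R := ereal_sup [set gauge_at Q | Q in [set: cube R n]].

End Gauge.

(* Main.v *)
(* After the substitution mu_I = lambda_I (|I| / |phi^-1 I|)^beta, admissibility
   reads sum_(I >= J) mu_I >= (|J| / |phi^-1 J|)^beta and the cost becomes
   sum_I mu_I |phi^-1 I|^beta <= C |Q|^beta.  These conditions chain: each
   quasi-cube phi^-1 I lies in a cube P_I of comparable size, and if nu^I is a
   good family for psi on P_I, then mu_I nu^I_L, placed on the boundedly many
   dyadic cubes of Q comparable to phi(L), is a good family for phi o psi.
   Only the comparability |phi^-1 I| ~ diam(phi^-1 I)^n is needed of the volume,
   and it follows from the three-point condition. *)
Require Import Defs.
From HB Require Import structures.
From mathcomp Require Import all_boot all_order all_algebra.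
From mathcomp Require Import finmap.
From mathcomp Require Import all_classical all_reals all_analysis.
From mathcomp Require Import ring lra.

Set Implicit Arguments.
Unset Strict Implicit.
Unset Printing Implicit Defensive.

Import Order.TTheory GRing.Theory Num.Theory.
Import numFieldNormedType.Exports.

Local Open Scope classical_set_scope.
Local Open Scope ring_scope.

(** * Unordered sums of nonnegative extended reals *)

Section ExtendedSums.
Variable R : realType.
Local Open Scope ereal_scope.

(** For fixed J, the condition for psi on P_I bounds the sum of nu^I_L over the L around phi^-1 J
    below by a multiple of (|phi^-1 J| / |psi^-1 phi^-1 J|)^beta. This bound does not involve I, so
    summing it against mu_I over I >= J cancels |phi^-1 J|^beta. In the cost, summing over L first
    leaves |P_I|^beta, which is comparable to |phi^-1 I|^beta, the weight that mu_I carries. The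
    obstacle is that quasi-cubes fit into no dyadic grid. In the grid of P_I, phi^-1 J is replaced
    by a cube M of comparable size whose closure contains the image of the center of J; M depends on
    I. In the grid of Q, phi(L) is replaced by a net of nearby cubes of one generation. Every J
    whose M lies in L has an ancestor in that net, so the lower bound loses only constants; if
    phi(L) is much larger than Q, the net contains at most Q itself. The size of a quasi-cube is the
    distance between the images of two fixed interior points, a quantity on which the three-point
    condition acts directly. *)

Lemma esumZl (T : choiceType) (I : set T) (c : R) (a : T -> \bar R) :
  (0 <= c)%R -> (forall i, I i -> 0 <= a i) ->
  \esum_(i in I) (c%:E * a i) = c%:E * \esum_(i in I) a i.
Proof.
move=> c0 a0.
have le_c (b : T -> \bar R) (d : R) : (0 <= d)%R -> (forall i, I i -> 0 <= b i) ->
    \esum_(i in I) (d%:E * b i) <= d%:E * \esum_(i in I) b i.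
  move=> d0 b0; apply: ge_ereal_sup => _ [X [finX XI] <-].
  rewrite fsbig_finite//= big_seq -ge0_sume_distrr -?big_seq; last first.
    by move=> i; rewrite in_fset_set// inE => /XI /b0.
  rewrite lee_wpmul2l ?lee_fin//.
  by apply: esum_ge; exists X; rewrite // fsbig_finite.
apply/eqP; rewrite eq_le le_c//=.
have [->|cn0] := eqVneq c 0%R.
  by rewrite mul0e esum_ge0// => i _; rewrite mul0e.
have cp : (0 < c)%R by rewrite lt_def cn0.
(* The reverse inequality is [le_c] for the factor [c^-1]. *)
apply: (@le_trans _ _ (c%:E * (c^-1%:E * \esum_(i in I) (c%:E * a i)))).
  rewrite lee_wpmul2l ?lee_fin// (le_trans _ (le_c _ _ _ _)) ?invr_ge0//.
    by apply: le_esum => i _; rewrite muleA -EFinM mulVf// mul1e.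
  by move=> i Ii; rewrite mule_ge0 ?lee_fin ?a0.
by rewrite muleA -EFinM divff// mul1e.
Qed.

Lemma exchange_esum (T U : choiceType) (I : set T) (J : set U)
    (a : T -> U -> \bar R) : (forall i j, I i -> J j -> 0 <= a i j) ->
  \esum_(i in I) \esum_(j in J) a i j = \esum_(j in J) \esum_(i in I) a i j.
Proof.
move=> a0; rewrite esum_esum// esum_esum; last by move=> ? ? ? ?; exact: a0.
rewrite (reindex_esum (J `*` I) _ (fun x => (x.2, x.1)))//; split=> //=.
- by move=> [i j] [/=].
- by move=> [i1 i2] [j1 j2] /= _ _ [] -> ->.
- by move=> [i1 i2] [Pi1 Qi2] /=; exists (i2, i1).
Qed.

Lemma esum_subset (T : choiceType) (A B : set T) (a : T -> \bar R) :
  A `<=` B -> \esum_(i in A) a i <= \esum_(i in B) a i.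
Proof.
move=> AB; apply: ge_ereal_sup => _ [X [finX XA] <-].
by apply: esum_ge; exists X => //; split => //; apply: subset_trans AB.
Qed.

Lemma esum_le_card (T : choiceType) (F : finType) (f : F -> T) (S : {set F})
    (B : set T) (c : R) : B `<=` f @` [set` S] -> (0 <= c)%R ->
  \esum_(i in B) c%:E <= (#|S|%:R * c)%:E.
Proof.
move=> BS c0; apply: ge_ereal_sup => _ [X [finX XB] <-].
rewrite fsbig_finite//= sumEFin lee_fin.
rewrite big_const_seq count_predT iter_addr_0 -[leLHS]mulr_natl ler_wpM2r//.
rewrite ler_nat; apply: (@leq_trans (size [seq f i | i in S])); last first.
  by rewrite size_map -cardE.
apply: uniq_leq_size => // x; rewrite in_fset_set// inE => /XB/BS[i Si <-].
by apply/mapP; exists i => //; rewrite mem_enum.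
Qed.

End ExtendedSums.

(** * Moving products of weights from pairs of indices to single indices *)

Section Transfer.
Variables (R : realType) (T : choiceType) (D : set T) (E S : T -> set T).
Variables (mu : T -> R) (nu : T -> T -> R).
Hypothesis mu_ge0 : forall I, D I -> 0 <= mu I.
Hypothesis nu_ge0 : forall I L, D I -> E I L -> 0 <= nu I L.
Local Open Scope ereal_scope.

(** Each product is put in full on every member of [S L]. The test [J \in S k.2] stands in the
    summand so that the index set does not depend on [J] and sums can be exchanged. *)
Definition transfer J : \bar R :=
  \esum_(k in D `*`` E) if J \in S k.2 then (mu k.1 * nu k.1 k.2)%:E else 0.

Let term_ge0 J k : (D `*`` E) k ->
  0 <= if J \in S k.2 then (mu k.1 * nu k.1 k.2)%:E else 0.
Proof.
move=> [Dk Ek]; case: ifP => // _.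
by rewrite lee_fin mulr_ge0 ?mu_ge0 ?nu_ge0.
Qed.

Lemma transfer_ge0 J : 0 <= transfer J.
Proof. by apply: esum_ge0 => k; exact: term_ge0. Qed.

(** After exchanging the sums, a pair [(I, L)] is charged the sum of [c] over [S L], where [c] is at
    most [d L] and constants are multiplied by at most [N]. *)
Lemma transfer_cost (c d : T -> R) (N : R) :
    (forall J, 0 <= c J)%R -> (0 <= N)%R -> (forall J, 0 <= d J)%R ->
    (forall L J, S L J -> c J <= d L)%R ->
    (forall L b, (0 <= b)%R -> \esum_(J in S L) b%:E <= (N * b)%:E) ->
  \esum_(J in D) ((c J)%:E * transfer J) <=
  N%:E * \esum_(I in D) ((mu I)%:E * \esum_(L in E I) (nu I L * d L)%:E).
Proof.
move=> c0 N0 d0 cd SN.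
have -> : \esum_(J in D) ((c J)%:E * transfer J) =
    \esum_(J in D) \esum_(k in D `*`` E)
      ((c J)%:E * if J \in S k.2 then (mu k.1 * nu k.1 k.2)%:E else 0).
  by apply: eq_esum => J _; rewrite esumZl// => k; exact: term_ge0.
rewrite exchange_esum; last first.
  by move=> J k _ Wk; rewrite mule_ge0 ?lee_fin// term_ge0.
have -> : \esum_(I in D) ((mu I)%:E * \esum_(L in E I) (nu I L * d L)%:E) =
    \esum_(k in D `*`` E) (mu k.1 * (nu k.1 k.2 * d k.2))%:E.
  rewrite -(@esum_esum _ _ _ D E (fun I L => (mu I * (nu I L * d L))%:E)).
    apply: eq_esum => I DI; rewrite -esumZl ?mu_ge0//.
    by move=> L EL; rewrite lee_fin mulr_ge0 ?nu_ge0.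
  by move=> I L DI EL; rewrite lee_fin mulr_ge0 ?mu_ge0// mulr_ge0 ?nu_ge0.
rewrite -esumZl//; last first.
  by move=> k [Dk Ek]; rewrite lee_fin mulr_ge0 ?mu_ge0// mulr_ge0 ?nu_ge0.
apply: le_esum => k [Dk Ek]; rewrite -EFinM.
have mn0 : (0 <= mu k.1 * nu k.1 k.2)%R by rewrite mulr_ge0 ?mu_ge0 ?nu_ge0.
apply: le_trans (SN k.2 _ _); last by rewrite mulr_ge0 ?mu_ge0// mulr_ge0 ?nu_ge0.
apply: (@le_trans _ _ (\esum_(J in D `&` S k.2)
  (mu k.1 * (nu k.1 k.2 * d k.2))%:E)); last by apply: esum_subset => J [].
rewrite esum_mkcondr; apply: le_esum => J DJ; case: ifP => [|_]; last first.
  by rewrite mule0.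
by rewrite inE => /cd cJ; rewrite -EFinM lee_fin mulrA mulrC ler_wpM2l.
Qed.

(** Since [F] meets [S L], each product on the left is counted at least once on the right. In the
    application [F] is the set of ancestors of a fixed cube. *)
Lemma transfer_lower (F : set T) (G : T -> set T) : F `<=` D ->
    (forall I, F I -> G I `<=` E I) ->
    (forall I L, F I -> G I L -> F `&` S L !=set0) ->
  \esum_(I in F) ((mu I)%:E * \esum_(L in G I) (nu I L)%:E) <=
  \esum_(J in F) transfer J.
Proof.
move=> FD GE FS; rewrite exchange_esum; last by move=> J k _; exact: term_ge0.
have -> : \esum_(I in F) ((mu I)%:E * \esum_(L in G I) (nu I L)%:E) =
    \esum_(k in F `*`` G) (mu k.1 * nu k.1 k.2)%:E.
  rewrite -(@esum_esum _ _ _ F G (fun I L => (mu I * nu I L)%:E)).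
    apply: eq_esum => I FI; rewrite -esumZl//; first exact/mu_ge0/FD.
    by move=> L /(GE _ FI) EL; rewrite lee_fin nu_ge0//; exact: FD.
  move=> I L FI /(GE _ FI) EL.
  by rewrite lee_fin mulr_ge0//; [exact/mu_ge0/FD|exact: nu_ge0 (FD _ FI) EL].
apply: (@le_trans _ _ (\esum_(k in F `*`` G) \esum_(J in F)
    if J \in S k.2 then (mu k.1 * nu k.1 k.2)%:E else 0)); last first.
  by apply: esum_subset => k [/= Fk Gk]; split=> /=; [exact: FD|exact: GE Gk].
apply: le_esum => k [Fk Gk]; have [J [FJ SJ]] := FS _ _ Fk Gk.
have mn0 : (0 <= mu k.1 * nu k.1 k.2)%R.
  by rewrite mulr_ge0//; [exact/mu_ge0/FD|exact: nu_ge0 (FD _ Fk) (GE _ Fk _ Gk)].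
apply: esum_ge; exists [set J]; first by split=> // _ ->.
by rewrite fsbig_set1 ifT// inE.
Qed.

End Transfer.

(** * Cubes and their subcubes in the sup norm *)

Section CubeGeometry.
Variables (R : realType) (n : nat).
Implicit Types (x y : 'rV[R]_n) (I J Q : cube R n).

Lemma coord_le_norm x i : `|x ord0 i| <= `|x|.
Proof.
rewrite [leRHS]/Num.norm/= mx_normrE.
by apply: le_trans (le_bigmax _ _ (ord0, i)).
Qed.

Lemma norm_le_coord x r : 0 <= r -> (forall i, `|x ord0 i| <= r) -> `|x| <= r.
Proof.
move=> r0 xr; rewrite [leLHS]/Num.norm/= mx_normrE; apply: bigmax_le => // -[i j] _ /=.
by rewrite ord1.
Qed.

Lemma norm_lt_coord x r : 0 < r -> (forall i, `|x ord0 i| < r) -> `|x| < r.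
Proof.
move=> r0 xr; rewrite [ltLHS]/Num.norm/= mx_normrE; apply: bigmax_lt => // -[i j] _ /=.
by rewrite ord1.
Qed.

Lemma norm_const_mx (a : R) : (0 < n)%N -> `|const_mx a : 'rV[R]_n| = `|a|.
Proof.
move=> n0; apply/eqP; rewrite eq_le norm_le_coord//=; last first.
  by move=> i; rewrite mxE.
by have := coord_le_norm (const_mx a) (Ordinal n0); rewrite mxE.
Qed.

Definition center Q : 'rV[R]_n := \row_i (corner Q ord0 i + (side Q)%:num / 2).

(* A second point of the interior, so that [`|g (center Q) - g (marker Q)|]
   measures the size of the image of [Q] under a quasisymmetric map [g]. *)
Definition marker Q : 'rV[R]_n :=
  \row_i (corner Q ord0 i + 3 * (side Q)%:num / 4).

Lemma center_marker Q : (0 < n)%N ->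
  `|center Q - marker Q| = (side Q)%:num / 4.
Proof.
move=> n0; rewrite (_ : _ - _ = const_mx (- ((side Q)%:num / 4))).
  by rewrite norm_const_mx// normrN ger0_norm.
by apply/rowP => i; rewrite !mxE; field.
Qed.

Lemma pts_center_dist Q x : pts Q x -> `|center Q - x| <= (side Q)%:num / 2.
Proof.
move=> Qx; apply: norm_le_coord => // i; have := Qx i.
rewrite !mxE; case: Q {Qx} => c s [] [] /=; rewrite in_itv/= ler_norml => /andP[];
  lra.
Qed.

Lemma center_dist_pts Q x : `|center Q - x| < (side Q)%:num / 2 -> pts Q x.
Proof.
move=> Qx i; have := le_lt_trans (coord_le_norm (center Q - x) i) Qx.
rewrite !mxE; case: Q {Qx} => c s [] [] /=; rewrite in_itv/= ltr_norml => /andP[];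
  lra.
Qed.

Lemma pts_center Q : pts Q (center Q).
Proof. by apply: center_dist_pts; rewrite subrr normr0. Qed.

Lemma pts_marker Q : pts Q (marker Q).
Proof.
case: (posnP n) => [n0|n0].
  by move=> i; have := leq_trans (ltn_ord i) (eq_leq n0).
by apply: center_dist_pts; rewrite center_marker// ltr_pM2l// ltf_pV2// ?posrE// ltr_nat.
Qed.

Lemma sub_pts I J :
    lower_closed J = lower_closed I -> upper_closed J = upper_closed I ->
    (forall i, corner I ord0 i <= corner J ord0 i) ->
    (forall i, corner J ord0 i + (side J)%:num <=
               corner I ord0 i + (side I)%:num) ->
  pts J `<=` pts I.
Proof.
case: I J => [cI sI lI uI] [cJ sJ lJ uJ] /= -> -> lo up x Jx i.
move: (lo i) (up i) (Jx i); rewrite /= !in_itv/=.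
by case: lI {Jx}; case: uI => /=; move=> ? ? /andP[? ?]; apply/andP; split; lra.
Qed.

(** The factor 4 is crude: comparing only two interior points of [J] treats open, closed and
    half-open cubes alike. *)
Lemma pts_sub_side I J : (0 < n)%N -> pts J `<=` pts I ->
  (side J)%:num <= 4 * (side I)%:num.
Proof.
move=> n0 JI.
have := pts_center_dist (JI _ (pts_center J)).
have := pts_center_dist (JI _ (pts_marker J)).
have := center_marker J n0.
have := ler_distD (center I) (center J) (marker J).
rewrite (distrC (center J) (center I)); lra.
Qed.

(** A distance bound replaces membership because the subcubes of an open cube miss the bisecting
    hyperplanes. *)
Lemma subcube_near Q k y : `|center Q - y| < (side Q)%:num / 2 ->
  exists j, `|center (@subcube R n Q k j) - y| <= (side Q)%:num / 2 ^+ k / 2.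
Proof.
move=> Qy; set d := (side Q)%:num / 2 ^+ k.
have d0 : 0 < d by rewrite divr_gt0// exprn_gt0.
have yi i : 0 <= y ord0 i - corner Q ord0 i < (side Q)%:num.
  have := le_lt_trans (coord_le_norm (center Q - y) i) Qy.
  by rewrite !mxE ltr_norml => /andP[? ?]; apply/andP; split; lra.
pose t i := Num.truncn ((y ord0 i - corner Q ord0 i) / d).
have tE i : (t i)%:R * d <= y ord0 i - corner Q ord0 i < (t i).+1%:R * d.
  have /andP[yi0 _] := yi i.
  by rewrite -ler_pdivlMr// -ltr_pdivrMr// truncn_itv// divr_ge0// ltW.
have t_lt i : (t i < 2 ^ k)%N.
  have dk : 2 ^+ k * d = (side Q)%:num by rewrite mulrCA divff ?mulr1 ?expf_neq0.
  rewrite -(ltr_nat R) natrX -(ltr_pM2r d0) dk.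
  by have /andP[_] := yi i; apply: le_lt_trans; have /andP[] := tE i.
exists [ffun i => Ordinal (t_lt i)]; apply: norm_le_coord => [|i].
  by rewrite divr_ge0// ltW.
rewrite !mxE ffunE /= -/d; have := tE i.
by rewrite -natr1 mulrDl mul1r ler_norml => /andP[? ?]; apply/andP; split; lra.
Qed.

Lemma subcube_ancestor Q k m (j : {ffun 'I_n -> 'I_(2 ^ m)}) : (k <= m)%N ->
  exists j', pts (subcube Q j) `<=` pts (@subcube R n Q k j').
Proof.
move=> km; have N0 : (0 < 2 ^ (m - k))%N by rewrite expn_gt0.
have lt_div i : (j i %/ 2 ^ (m - k) < 2 ^ k)%N.
  by rewrite ltn_divLR// -expnD subnKC.
exists [ffun i => Ordinal (lt_div i)].
set d := (side Q)%:num / 2 ^+ m.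
have d0 : 0 < d by rewrite divr_gt0// exprn_gt0.
have dE : (side Q)%:num / 2 ^+ k = (2 ^ (m - k))%:R * d.
  rewrite /d natrX -{2}(subnKC km) exprD; field.
  by rewrite !expf_neq0.
apply: sub_pts => //= i; rewrite !mxE ffunE/= dE -/d.
  by rewrite lerD2l mulrA -natrM ler_pM2r// ler_nat leq_trunc_div.
rewrite -!addrA lerD2l mulrA -natrM -!mulrDl -[X in X <= _]mulr1.
rewrite [X in _ <= X](_ : _ = ((j i %/ 2 ^ (m - k)).+1 * 2 ^ (m - k))%:R * d).
  rewrite mulr1 -[X in _ + X]mul1r -mulrDl natr1 ler_pM2r// ler_nat.
  by rewrite -ltn_divLR.
by rewrite mulSn natrD addrC.
Qed.

End CubeGeometry.

(** * Outer measure of sets squeezed between two balls *)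

Section LebesgueBounds.
Variables (R : realType) (n : nat).
Implicit Types (x c : 'rV[R]_n) (Q : cube R n).

(* Reduction modulo [m] is injective on [S]. *)
Lemma card_ffun_window N m (S : {set {ffun 'I_n -> 'I_N}}) : (0 < m)%N ->
  (forall j j' i, j \in S -> j' \in S -> (j i < j' i + m)%N) ->
  (#|S| <= m ^ n)%N.
Proof.
case: m => // m _ Sm.
pose f (j : {ffun 'I_n -> 'I_N}) : {ffun 'I_n -> 'I_m.+1} :=
  [ffun i => inord (j i %% m.+1)].
rewrite -[X in (_ <= _ ^ X)%N](card_ord n) -[X in (_ <= X ^ _)%N](card_ord m.+1).
rewrite -card_ffun; apply: (@leq_trans #|f @: S|); last exact: max_card.
rewrite card_in_imset// => j j' jS j'S /ffunP ff; apply/ffunP => i.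
have := ff i; rewrite !ffunE => /(congr1 val); rewrite /= !inordK ?ltn_mod// => e.
have [a b] := (Sm _ _ i jS j'S, Sm _ _ i j'S jS); apply/val_inj => /=.
have lt_div k l : (k < l + m.+1)%N -> k = l %[mod m.+1] ->
    (k %/ m.+1 <= l %/ m.+1)%N.
  move=> kl kl_mod; rewrite -ltnS -(ltn_pmul2r (ltn0Sn m)) mulSn addnC.
  by rewrite -(ltn_add2r (k %% m.+1)%N) -divn_eq addnAC kl_mod -divn_eq.
rewrite (divn_eq (j i) m.+1) (divn_eq (j' i) m.+1) e; congr (_ * _ + _)%N.
by apply/eqP; rewrite eqn_leq !lt_div.
Qed.

(** The volume inequality for finite covers, up to a factor [4 ^ n], by counting: [N ^ n] lattice
    points have to be shared among the cubes, and [N ^ n] cancels at the end. *)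
Lemma lattice_cover (a : 'rV[R]_n) (s : R) (D : seq (cube R n)) : 0 < s ->
    (forall x, (forall i, a ord0 i <= x ord0 i <= a ord0 i + s) ->
      exists2 Q, Q \in D & `|center Q - x| < (side Q)%:num) ->
  (s / 4) ^+ n <= \sum_(Q <- D) (side Q)%:num ^+ n.
Proof.
move=> s0 cov.
(* The sum dominates each of its terms, so the mesh [s / N] is at most the side of every cube in
   [D]. *)
pose N := (\sum_(Q <- D) (Num.truncn (s / (side Q)%:num)).+1).+1.
have N0 : 0 < N%:R :> R by rewrite ltr0n.
have sN0 : 0 < s / N%:R by rewrite divr_gt0.
have NQ Q : Q \in D -> s / N%:R <= (side Q)%:num.
  move=> DQ; rewrite ler_pdivrMr// mulrC -ler_pdivrMr//.
  apply/ltW/(lt_le_trans (truncnS_gt _)); rewrite ler_nat /N.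
  by rewrite (big_rem _ DQ)/= ltnS ltnW// ltnS leq_addr.
pose p (j : {ffun 'I_n -> 'I_N}) : 'rV[R]_n :=
  \row_i (a ord0 i + (j i)%:R * (s / N%:R)).
pose S Q := finset (fun j => `|center Q - p j| < (side Q)%:num).
(* Two lattice points near [center Q] have indices differing by less than [y]; as [y >= 2], rounding
   [y] up to an integer at most doubles it. *)
have cardS Q : Q \in D -> #|S Q|%:R <= (4 * (side Q)%:num / (s / N%:R)) ^+ n.
  move=> DQ; set y := 2 * (side Q)%:num / (s / N%:R).
  have y2 : 2 <= y by rewrite ler_pdivlMr// ler_pM2l// NQ.
  pose m := (Num.truncn y).+1.
  have my : y < m%:R by exact: truncnS_gt.
  have ym : m%:R <= 4 * (side Q)%:num / (s / N%:R).
    rewrite -[leLHS]natr1; have : (Num.truncn y)%:R <= y by rewrite truncn_le; lra.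
    have -> : 4 * (side Q)%:num / (s / N%:R) = 2 * y.
      by rewrite /y; ring.
    lra.
  apply: (@le_trans _ _ ((m ^ n)%:R)); last first.
    by rewrite natrX lerXn2r// nnegrE// (le_trans _ ym).
  rewrite ler_nat; apply: card_ffun_window => // j j' i; rewrite !inE => jS j'S.
  rewrite -(ltr_nat R) natrD.
  have := le_lt_trans (coord_le_norm (center Q - p j) i) jS.
  have := le_lt_trans (coord_le_norm (center Q - p j') i) j'S.
  rewrite !mxE !ltr_norml => /andP[? ?] /andP[? ?].
  suff : (j i)%:R - (j' i)%:R < y by lra.
  by rewrite /y ltr_pdivlMr// mulrBl; lra.
have card_le : (N ^ n <= \sum_(Q <- D) #|S Q|)%N.
  rewrite -[X in (_ ^ X)%N](card_ord n) -[X in (X ^ _)%N](card_ord N) -card_ffun.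
  rewrite -sum1_card; under [X in (_ <= X)%N]eq_bigr do rewrite -sum1_card big_mkcond.
  rewrite exchange_big/=; apply: leq_sum => j _.
  have [|Q DQ Qp] := cov (p j).
    move=> i; rewrite mxE; have lej : (j i)%:R <= N%:R :> R by rewrite ler_nat ltnW.
    rewrite lerDl lerD2l mulr_ge0 ?(ltW sN0)//= mulrCA ger_pMr// ler_pdivrMr// mul1r//.
  by rewrite (big_rem _ DQ)/= inE Qp.
have : (N ^ n)%:R <= \sum_(Q <- D) (4 * (side Q)%:num / (s / N%:R)) ^+ n.
  apply: (@le_trans _ _ (\sum_(Q <- D) #|S Q|)%:R); first by rewrite ler_nat.
  by rewrite natr_sum big_seq [leRHS]big_seq; apply: ler_sum.
under eq_bigr => Q _.
  rewrite (_ : _ / _ = (4 / s * N%:R) * (side Q)%:num); last first.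
    by field; rewrite !gt_eqF.
  rewrite exprMn; over.
rewrite -mulr_sumr natrX exprMn [_ * N%:R ^+ n]mulrC -mulrA ler_pMr ?exprn_gt0//.
move=> h; rewrite -(@ler_pM2l _ ((4 / s) ^+ n)) ?exprn_gt0 ?divr_gt0//.
by rewrite -exprMn (_ : _ * _ = 1) ?expr1n//; field; rewrite gt_eqF.
Qed.

(** Covering cubes need not be open, so each is enlarged to the open ball of radius [side Q] about
    its center; compactness of the closed box of side [r] about [c] then leaves a finite cover. *)
Lemma lebesgue_ball_ge c r (E : set 'rV[R]_n) : 0 < r ->
  (forall x, `|c - x| < r -> E x) -> (((r / 4) ^+ n)%:E <= lebesgue E)%E.
Proof.
move=> r0 cE; apply: le_ereal_inf_tmp => _ [F [cF EF] <-].
pose a := \row_i (c ord0 i - r / 2).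
pose B : set 'rV[R]_n :=
  [set v : 'rV[R]_n | forall i, `[a ord0 i, a ord0 i + r]%classic (v ord0 i)].
have : compact B by apply: (@rV_compact _ _ (fun i => `[a ord0 i, a ord0 i + r]%classic)) => i;
    exact: segment_compact.
rewrite compact_cover => /(_ _ F (fun Q => ball (center Q) (side Q)%:num)).
case=> [Q _||D DF BD]; first exact: ball_open.
  move=> x Bx; have /EF[Q FQ Qx] : E x.
    apply: cE; apply: norm_lt_coord => // i; have := Bx i.
    by rewrite /a /= in_itv/= !mxE ltr_norml => /andP[? ?]; apply/andP; split; lra.
  exists Q => //; rewrite -ball_normE/=; apply: le_lt_trans (pts_center_dist Qx) _.
  by rewrite ltr_pdivrMr// ltr_pMr// ltr1n.
apply: esum_ge; exists [set` D].
  by split=> // Q /DF; rewrite inE.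
rewrite fsbig_finite//= set_fsetK sumEFin lee_fin.
apply: (lattice_cover (a := a)) => // x Bx.
have [Q DQ Qx] := BD x (fun i => Bx i); exists Q => //.
by move: Qx; rewrite -ball_normE.
Qed.

Lemma lebesgue_ball_le c r (E : set 'rV[R]_n) : 0 < r ->
  (forall x, E x -> `|c - x| <= r) -> (lebesgue E <= ((2 * r) ^+ n)%:E)%E.
Proof.
move=> r0 Ec.
pose Q := Cube (\row_i (c ord0 i - r)) (PosNum (mulr_gt0 (ltr0n R 2) r0)) true true.
apply: ereal_inf_lbound; exists [set Q]; last by rewrite esum_set1 ?lee_fin.
split; first exact: countable1.
move=> x /Ec cx; exists Q => // i; rewrite in_itv/= mxE.
have := le_trans (coord_le_norm (c - x) i) cx.
by rewrite !mxE ler_norml => /andP[? ?]; apply/andP; split; lra.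
Qed.

(** The two bounds force the outer measure to be finite, so [fine] does not return its default
    value. *)
Lemma vol_bounds c c' r r' (E : set 'rV[R]_n) : 0 < r -> 0 < r' ->
    (forall x, `|c - x| < r -> E x) -> (forall x, E x -> `|c' - x| <= r') ->
  (r / 4) ^+ n <= vol E <= (2 * r') ^+ n.
Proof.
move=> r0 r'0 cE Ec; have := lebesgue_ball_ge r0 cE.
have := lebesgue_ball_le r'0 Ec; rewrite /vol.
by case: lebesgue => [v||] //=; rewrite !lee_fin => -> ->.
Qed.

End LebesgueBounds.

(** * The three-point condition and the volume of quasi-cubes *)

Section ThreePoint.
Variables (R : realType) (n : nat).
Implicit Types (x y z : 'rV[R]_n) (f g : 'rV[R]_n -> 'rV[R]_n) (I J : cube R n).

Lemma norm_le_enorm x : `|x| <= enorm x.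
Proof.
apply: norm_le_coord => [|i]; first exact: sqrtr_ge0.
rewrite -sqrtr_sqr ler_wsqrtr// (bigD1 i)//= lerDl.
by apply: sumr_ge0 => *; exact: sqr_ge0.
Qed.

Lemma enorm_le_norm x : enorm x <= n%:R * `|x|.
Proof.
rewrite -[leRHS]ger0_norm ?mulr_ge0// -sqrtr_sqr ler_wsqrtr//.
apply: (@le_trans _ _ (\sum_(i < n) `|x| ^+ 2)).
  apply: ler_sum => i _; rewrite -[leLHS]real_normK ?num_real//.
  by rewrite lerXn2r// ?nnegrE// coord_le_norm.
rewrite sumr_const card_ord -[leLHS]mulr_natl exprMn ler_wpM2r ?sqr_ge0//.
by rewrite -natrX ler_nat; case: (n) => // m; rewrite -mulnn leq_pmulr.
Qed.

(** Of the modulus [eta] only one constant per ratio is kept, so composition just feeds one constant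
    into the next. Products instead of quotients admit coinciding points, and the sup norm fits the
    cubes. *)
Definition three_point f := forall t : R, exists2 C : R, 1 <= C &
  forall x y z, `|x - y| <= t * `|x - z| -> `|f x - f y| <= C * `|f x - f z|.

Lemma three_point_id : three_point id.
Proof.
move=> t; exists (Num.max 1 t) => [|x y z /le_trans]; first by rewrite le_max lexx.
by apply; rewrite ler_wpM2r// le_max lexx orbT.
Qed.

Lemma three_point_comp f g : three_point f -> three_point g ->
  three_point (f \o g).
Proof.
move=> hf hg t; have [C C1 gC] := hg t; have [C' C'1 fC] := hf C.
by exists C' => // x y z /gC/fC.
Qed.

Lemma quasisymmetric_three_point f : (0 < n)%N -> quasisymmetric f ->
  exists g, [/\ cancel f g, cancel g f, three_point f & three_point g].
Proof.
move=> n_gt0 [[fbij _ _] [eta [[[eta_fun eta_inj eta_surj] _ _] eta_mono eta0 feta]]].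
have n0 : 0 < n%:R :> R by rewrite ltr0n.
have [g fg gf] : bijective f by rewrite -setTT_bijective.
have finj := can_inj fg.
have eta_le s t : 0 <= s -> s <= t -> eta s <= eta t.
  move=> s0; rewrite le_eqVlt => /predU1P[->//|st]; apply/ltW/eta_mono => //.
    by rewrite in_itv/= s0.
  by rewrite in_itv/= (le_trans s0)// ltW.
have dist_gt0 x y : x <> y -> 0 < `|x - y|.
  by move=> /eqP xy; rewrite normr_gt0 subr_eq0.
have enorm_gt0 x y : x <> y -> 0 < enorm (x - y).
  by move=> /dist_gt0 xy; apply: lt_le_trans xy (norm_le_enorm _).
(* The hypothesis and the conclusion each lose a factor [n] in passing between the Euclidean and the
   sup norm. *)
have fdist x y z s : x <> y -> x <> z -> y <> z -> n%:R * `|x - y| <= s * `|x - z| ->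
    `|f x - f y| <= n%:R * eta s * `|f x - f z|.
  move=> xy xz yz xyz.
  apply: le_trans (norm_le_enorm _) _.
  apply: (@le_trans _ _ (eta s * enorm (f x - f z))); last first.
    rewrite -mulrA mulrCA ler_wpM2l ?enorm_le_norm//.
    rewrite -eta0 eta_le// -(pmulr_lge0 _ (dist_gt0 _ _ xz)).
    by apply: le_trans xyz; rewrite mulr_ge0.
  rewrite -ler_pdivrMr; last by apply: enorm_gt0 => /finj.
  apply: le_trans (feta _ _ _ xy xz yz) _; apply: eta_le.
    by rewrite divr_ge0// sqrtr_ge0.
  rewrite ler_pdivrMr ?enorm_gt0//.
  have s0 : 0 <= s.
    rewrite -(pmulr_lge0 _ (dist_gt0 _ _ xz)).
    by apply: le_trans xyz; rewrite mulr_ge0.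
  apply: le_trans (enorm_le_norm _) (le_trans xyz _).
  by rewrite ler_wpM2l// norm_le_enorm.
exists g; split=> // t.
  exists (Num.max 1 (n%:R * eta (n%:R * t))) => [|x y z xyz].
    by rewrite le_max lexx.
  have [<-|xy] := pselect (x = y); first by rewrite subrr normr0 mulr_ge0// le_max ler01.
  have [yz|yz] := pselect (y = z).
    by rewrite yz ler_peMl// le_max lexx.
  have [xz|xz] := pselect (x = z).
    by move: xyz; rewrite -xz subrr normr0 mulr0 leNgt dist_gt0.
  apply: le_trans (fdist _ _ _ (n%:R * t) xy xz yz _) _.
    by rewrite -mulrA ler_wpM2l.
  by rewrite ler_wpM2r// le_max lexx orbT.
pose u := Num.max 1 t; have u0 : 0 < u by rewrite lt_max ltr01.
have v0 : 0 < (n%:R * 2 * u)^-1 by rewrite invr_gt0 !mulr_gt0.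
(* Surjectivity of [eta] supplies this small value. If [x - y] were more than [n / s] times as long
   as [x - z], then [f x - f y] would be at least [2 * u] times as long as [f x - f z], against the
   assumed ratio [t <= u]. *)
have [s] : [set eta s | s in `[0, +oo[] (n%:R * 2 * u)^-1.
  by apply: eta_surj; rewrite /= in_itv/= ltW.
rewrite /= in_itv/= andbT => s_ge0 etas.
have s0 : 0 < s.
  rewrite lt_def s_ge0 andbT; apply: contraTN v0 => /eqP s0.
  by rewrite -etas s0 eta0 ltxx.
exists (Num.max 1 (n%:R / s)) => [|x' y' z']; first by rewrite le_max lexx.
rewrite -[x']gf -[y']gf -[z']gf; move: (g x') (g y') (g z') => x y z.
rewrite !fg => xyz.
have [<-|xy] := pselect (x = y); first by rewrite subrr normr0 mulr_ge0// le_max ler01.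
have [yz|yz] := pselect (y = z).
  by rewrite yz ler_peMl// le_max lexx.
have [xz|xz] := pselect (x = z).
  move: xyz; rewrite -xz subrr normr0 mulr0 leNgt dist_gt0//.
  by move/finj.
rewrite leNgt; apply/negP => xyz'.
have hs : n%:R * `|x - z| <= s * `|x - y|.
  rewrite (_ : _ * `|x - z| = s * (n%:R / s * `|x - z|)); last first.
    by field; rewrite gt_eqF.
  by rewrite ler_wpM2l// (le_trans _ (ltW xyz'))// ler_wpM2r// le_max lexx orbT.
have := fdist x z y s xz xy (fun e => yz (esym e)) hs.
rewrite etas (_ : n%:R * (n%:R * 2 * u)^-1 = (2 * u)^-1); last first.
  by field; rewrite !gt_eqF.
rewrite mulrC ler_pdivlMr ?mulr_gt0// => h.
have fxz : 0 < `|f x - f z| by apply: dist_gt0 => /finj.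
have : `|f x - f y| <= u * `|f x - f z|.
  by apply: le_trans xyz _; rewrite ler_wpM2r// le_max lexx orbT.
have : 0 < u * `|f x - f z| by rewrite mulr_gt0.
lra.
Qed.

Definition image_size g I : R := `|g (center I) - g (marker I)|.

Lemma image_size_gt0 g I : (0 < n)%N -> injective g -> 0 < image_size g I.
Proof.
move=> n0 gi; rewrite normr_gt0 subr_eq0 (inj_eq gi) -subr_eq0 -normr_gt0.
by rewrite center_marker// divr_gt0.
Qed.

Definition sized (V rho : cube R n -> R) := exists2 C : R, 0 < C &
  forall I, (rho I / C) ^+ n <= V I <= (C * rho I) ^+ n.

(** This lets the geometry of the composition be done with distances alone. *)
Lemma sized_le (V V' rho rho' : cube R n -> R) (A : R) : 0 < A ->
    (forall I, 0 <= rho I) -> (forall I, 0 <= rho' I) ->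
    sized V rho -> sized V' rho' ->
  exists2 B : R, 0 < B & forall I J, rho I <= A * rho' J -> V I <= B * V' J.
Proof.
move=> A0 rho0 rho'0 [C C0 VC] [C' C'0 VC'].
exists ((C * A * C') ^+ n) => [|I J IJ]; first by rewrite exprn_gt0// !mulr_gt0.
have /andP[_ /le_trans] := VC I; apply.
apply: (@le_trans _ _ ((C * A * C') ^+ n * (rho' J / C') ^+ n)); last first.
  by rewrite ler_wpM2l ?exprn_ge0 ?mulr_ge0 ?(ltW C0) ?(ltW A0) ?(ltW C'0)//;
    have /andP[] := VC' J.
rewrite -exprMn lerXn2r ?nnegrE ?mulr_ge0 ?invr_ge0 ?(ltW C0) ?(ltW A0) ?(ltW C'0)//.
have -> : C * A * C' * (rho' J / C') = C * (A * rho' J) by field; rewrite gt_eqF.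
by rewrite ler_wpM2l// ltW.
Qed.

Lemma image_pts g : three_point g -> (0 < n)%N ->
  exists2 C : R, 1 <= C & forall I x, pts I x ->
    `|g (center I) - g x| <= C * image_size g I.
Proof.
(* The ratio 2 is half a side against the quarter of a side between center and marker. *)
move=> g3 n0; have [C C1 gC] := g3 2; exists C => // I x Ix; apply: gC.
by have := pts_center_dist Ix; rewrite center_marker//; lra.
Qed.

(** The outer ball comes from [image_pts]. For the inner one, a point outside [I] is farther from
    the center than the marker is, so the condition with ratio 1 keeps its image under [g] at least
    [image_size g I / C'] away. *)
Lemma sized_preimage f g : (0 < n)%N -> cancel f g -> cancel g f ->
    three_point g ->
  sized (fun I => vol (f @^-1` pts I)) (image_size g).
Proof.
move=> n0 fg gf g3; have [C C1 gC] := image_pts g3 n0.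
have [C' C'1 gC'] := g3 1.
have C0 : 0 < C by lra.
have C'0 : 0 < C' by lra.
pose m := Num.max (2 * C) (4 * C').
have Cm : 2 * C <= m by rewrite le_max lexx.
have C'm : C' * 4 <= m by rewrite mulrC le_max lexx orbT.
have m0 : 0 < m by lra.
exists m => // I.
have rho0 := image_size_gt0 I n0 (can_inj gf).
have /andP[lo up] : (image_size g I / C' / 4) ^+ n <= vol (f @^-1` pts I)
    <= (2 * (C * image_size g I)) ^+ n.
  apply: (@vol_bounds _ _ (g (center I)) (g (center I))).
  - by rewrite divr_gt0.
  - by rewrite mulr_gt0.
  - move=> x; rewrite ltNge => /negP h; apply: contrapT => Ix; apply: h.
    rewrite -[x in leRHS]fg ler_pdivrMr// mulrC; apply: gC'.
    rewrite mul1r center_marker// leNgt; apply/negP => h; apply: Ix.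
    by apply: center_dist_pts; have : 0 < (side I)%:num by []; lra.
  - by move=> x /gC; rewrite fg.
apply/andP; split; [apply: le_trans lo|apply: le_trans up _].
  rewrite lerXn2r ?nnegrE ?divr_ge0 ?(ltW rho0) ?(ltW m0) ?(ltW C'0)//.
  by rewrite -mulrA -invfM ler_wpM2l ?(ltW rho0)// lef_pV2 ?posrE ?mulr_gt0.
rewrite lerXn2r ?nnegrE ?mulr_ge0 ?(ltW rho0) ?(ltW C0) ?(ltW m0)//.
by rewrite mulrA ler_wpM2r ?(ltW rho0).
Qed.

Lemma vol_preimage_gt0 f g I : (0 < n)%N -> cancel f g -> cancel g f ->
  three_point g -> 0 < vol (f @^-1` pts I).
Proof.
move=> n0 fg gf g3; have [C C0 VC] := sized_preimage n0 fg gf g3.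
have /andP[lo _] := VC I; apply: lt_le_trans lo.
by rewrite exprn_gt0// divr_gt0// image_size_gt0//; exact: can_inj gf.
Qed.

End ThreePoint.

(** * Dyadic cubes of prescribed size and position *)

Section DyadicSelection.
Variables (R : realType) (n : nat).
Implicit Types (I J Q : cube R n).

Lemma exists_halving_le (a b : R) : 0 < a -> exists k, b / 2 ^+ k <= a.
Proof.
move=> a0; exists (Num.truncn (b / a)).+1; rewrite ler_pdivrMr ?exprn_gt0// mulrC.
rewrite -ler_pdivrMr//; apply: le_trans (ltW (truncnS_gt _)) _.
by rewrite -natrX ler_nat ltnW// ltn_expl.
Qed.

Lemma exists_halving_between (a b : R) : 0 < a -> a <= b ->
  exists k, a <= b / 2 ^+ k < 2 * a.
Proof.
move=> a0 ab; have [k] := exists_halving_le b a0; elim: k => [|k IH] h.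
  by exists 0; move: h; rewrite expr0 divr1; lra.
have [le_a|gt_a] := leP (b / 2 ^+ k) a; first exact: IH.
have [lt_2a|ge_2a] := ltP (b / 2 ^+ k) (2 * a); first by exists k; rewrite (ltW gt_a).
exists k.+1; move: h; rewrite exprS invfM mulrCA => h; apply/andP; split; lra.
Qed.

Lemma subcube_dyadic Q k j : dyadic Q (@subcube R n Q k j).
Proof. by exists k => //; exists j. Qed.

(* [S] collects the cubes of the first generation of side at most [s] that lie
   near [x]. *)
Lemma dyadic_net Q (x : 'rV[R]_n) (s : R) : 0 < s ->
  exists S : set (cube R n),
    [/\ S `<=` dyadic Q,
        forall I, S I -> (side I)%:num <= s /\ `|center I - x| <= s,
        forall b : R, 0 <= b -> (\esum_(I in S) b%:E <= (5 ^+ n * b)%:E)%E &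
        forall J, dyadic Q J -> (side J)%:num <= s -> `|center J - x| <= s / 2 ->
          exists2 I, S I & pts J `<=` pts I].
Proof.
move=> s0; have := exists_halving_le (side Q)%:num s0.
move=> /ex_minnP[k ks kmin].
set d := (side Q)%:num / 2 ^+ k in ks.
have d0 : 0 < d by rewrite divr_gt0// exprn_gt0.
(* By minimality of [k] the previous generation has side above [s]. At generation 0 the side may be
   far below [s], but there is only one cube. *)
have kd : k = 0%N \/ s < 2 * d.
  case: k @d ks kmin d0 => [|k] d ks kmin d0; [by left|right].
  rewrite ltNge; apply/negP => ds; have := kmin k; rewrite ltnn.
  suff -> : (side Q)%:num / 2 ^+ k = 2 * d by move=> /(_ ds).
  by rewrite /d exprS; field; rewrite expf_neq0.
pose X := finset (fun j : {ffun 'I_n -> 'I_(2 ^ k)} => `|center (subcube Q j) - x| <= s).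
exists (@subcube R n Q k @` [set` X]); split.
- by move=> _ [j _ <-]; exact: subcube_dyadic.
- by move=> _ [j /= + <-]; rewrite inE => Xj.
- move=> b b0; apply: le_trans (esum_le_card (f := @subcube R n Q k) (S := X) _ b0) _ => //.
  (* Centers within [s < 2 * d] of [x] have positions differing by less than 4 in each
     coordinate. *)
  rewrite lee_fin ler_wpM2r// -natrX ler_nat; apply: card_ffun_window => // j j' i.
  rewrite !inE => Xj Xj'; case: kd => [k0|sd].
    have k1 : (2 ^ k <= 5)%N by rewrite k0.
    by rewrite (leq_trans (ltn_ord _))// (leq_trans k1)// leq_addl.
  rewrite -(ltr_nat R) natrD -(ltr_pM2r d0).
  have := le_trans (coord_le_norm (center (subcube Q j) - x) i) Xj.
  have := le_trans (coord_le_norm (center (subcube Q j') - x) i) Xj'.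
  rewrite !mxE /= -/d !ler_norml => /andP[? ?] /andP[? ?]; lra.
- move=> J [m _ [j _ <-]] Js Jx.
  have km : (k <= m)%N by exact: kmin.
  have [j' j'j] := subcube_ancestor Q j km; exists (subcube Q j') => //.
  exists j' => //=; rewrite inE.
  (* The ancestor's center is within [d / 2 <= s / 2] of that of [J], which uses up the other half
     of [s]. *)
  have := pts_center_dist (j'j _ (pts_center _)).
  have := ler_distD (center (subcube Q j)) (center (subcube Q j')) x.
  rewrite [(side (subcube Q j'))%:num]/= -/d; lra.
Qed.

End DyadicSelection.

(** * Quasi-cubes against dyadic grids *)

Section CompositionGeometry.
Variables (R : realType) (n : nat) (phi G psi K : 'rV[R]_n -> 'rV[R]_n).
Hypotheses (n_gt0 : (0 < n)%N) (phiK : cancel phi G) (GK : cancel G phi)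
  (psiK : cancel psi K) (KK : cancel K psi).
Hypotheses (phi3 : three_point phi) (G3 : three_point G) (K3 : three_point K).
Implicit Types I J L M P Q : cube R n.

(** [P] is centered at [G (center I)], and its half-side is twice the radius of a ball containing
    the image of [I]. The slack gives the strict inequality needed to locate subcubes, and makes [P]
    large enough to be halved down to the size of any smaller image. *)
Lemma image_cube : exists2 C : R, 0 < C & forall I, exists P,
  [/\ image_size id P = C * image_size G I,
      forall J, pts J `<=` pts I ->
        `|center P - G (center J)| < (side P)%:num / 2 &
      forall J, pts J `<=` pts I -> image_size G J <= (side P)%:num].
Proof.
have [C C1 IC] := image_pts G3 n_gt0.
have C0 : 0 < C by lra.
exists C => // I; have rho0 := image_size_gt0 I n_gt0 (can_inj GK).
have s0 : 0 < 4 * (C * image_size G I) by rewrite !mulr_gt0.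
pose P := Cube (\row_i (G (center I) ord0 i - 2 * (C * image_size G I)))
  (PosNum s0) true true.
have cP : center P = G (center I).
  by apply/rowP => i; rewrite mxE /= mxE; lra.
exists P; split=> [|J JI|J JI].
- by rewrite {1}/image_size center_marker//=; lra.
- rewrite cP /=; apply: le_lt_trans (IC _ _ (JI _ (pts_center J))) _.
  by have := mulr_gt0 C0 rho0; lra.
- have := ler_distD (G (center I)) (G (center J)) (G (marker J)).
  have := IC _ _ (JI _ (pts_center J)); have := IC _ _ (JI _ (pts_marker J)).
  rewrite (distrC (G (center J)) (G (center I))) /image_size/=.
  by have := mulr_gt0 C0 rho0; rewrite /image_size; lra.
Qed.

Lemma image_dyadic P J : `|center P - G (center J)| < (side P)%:num / 2 ->
    image_size G J <= (side P)%:num ->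
  exists M, [/\ dyadic P M,
    image_size G J <= (side M)%:num < 2 * image_size G J &
    `|center M - G (center J)| <= (side M)%:num / 2].
Proof.
move=> PJ Jside; have rho0 := image_size_gt0 J n_gt0 (can_inj GK).
have [k kP] := exists_halving_between rho0 Jside.
have [j jJ] := subcube_near k PJ.
by exists (subcube P j); split=> //; exact: subcube_dyadic.
Qed.

(** The center and the marker of [M] both lie within [2 * image_size G J] of [G (center J)], which
    serves as the base point for [K]. *)
Lemma image_dyadic_size : exists2 A : R, 0 < A & forall J M,
  (side M)%:num < 2 * image_size G J ->
  `|center M - G (center J)| <= (side M)%:num / 2 ->
  image_size K M <= A * image_size (K \o G) J.
Proof.
have [C C1 KC] := K3 2; exists (2 * C) => [|J M MJ]; first by lra.
rewrite distrC => cMJ.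
have e1 : `|G (center J) - center M| <= 2 * `|G (center J) - G (marker J)|.
  by have := normr_ge0 (G (center J) - G (marker J)); rewrite /image_size in MJ; lra.
have e2 : `|G (center J) - marker M| <= 2 * `|G (center J) - G (marker J)|.
  have := ler_distD (center M) (G (center J)) (marker M).
  by rewrite center_marker//; rewrite /image_size in MJ; lra.
have := KC _ _ _ e1; have := KC _ _ _ e2.
have := ler_distD (K (G (center J))) (K (center M)) (K (marker M)).
by rewrite (distrC (K (center M)) (K (G _))) /image_size/=; lra.
Qed.

(* [S L] consists of the dyadic cubes of [Q] that are comparable to the
   quasi-cube [phi L]. *)
Lemma image_net : exists2 A : R, 0 < A & forall Q L, exists S : set (cube R n),
  [/\ S `<=` dyadic Q,
      forall b : R, 0 <= b -> (\esum_(I in S) b%:E <= (5 ^+ n * b)%:E)%E,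
      forall I, S I -> image_size (K \o G) I <= A * image_size K L &
      forall J M, dyadic Q J -> pts M `<=` pts L ->
        image_size G J <= (side M)%:num ->
        `|center M - G (center J)| <= (side M)%:num / 2 ->
        exists2 I, S I & pts J `<=` pts I].
Proof.
(* As [M] has at most 4 times the side of [L], the images of the center and marker of [J] lie within
   6.5 sides of [L] from [center L], that is 26 quarters. The cubes of the net have center and
   marker within [10 * H * r] of [phi (center L)], and 16 leaves room. *)
have [H H1 phiH] := phi3 26; have [C C1 KGC] := three_point_comp K3 G3 (16 * H).
exists (2 * C) => [|Q L]; first by lra.
set r := `|phi (center L) - phi (marker L)|.
have r0 : 0 < r by exact: image_size_gt0 (can_inj phiK).
have Hr0 : 0 < H * r by rewrite mulr_gt0//; lra.
(* The center and marker of [J] will both be within [H * r] of [phi (center L)], so the side of [J],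
   4 times their distance, is at most [8 * (H * r)]. *)
have s0 : 0 < 8 * (H * r) by lra.
have [S [SQ Snear Scard Sex]] := dyadic_net Q (phi (center L)) s0.
exists S; split=> // [I /Snear[Is]|J M QJ ML JM MJ].
  rewrite distrC => Ix.
  have e1 : `|phi (center L) - center I| <= 16 * H * r by lra.
  have e2 : `|phi (center L) - marker I| <= 16 * H * r.
    have := ler_distD (center I) (phi (center L)) (marker I).
    by rewrite center_marker//; lra.
  have := KGC _ _ _ e1; have := KGC _ _ _ e2; rewrite /= !phiK.
  have := ler_distD (K (center L)) (K (G (center I))) (K (G (marker I))).
  by rewrite (distrC (K (G (center I))) (K (center L))) /image_size/=; lra.
have sML := pts_sub_side n_gt0 ML.
have cML := pts_center_dist (ML _ (pts_center M)).
have e1 : `|center L - G (center J)| <= 26 * `|center L - marker L|.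
  have := ler_distD (center M) (center L) (G (center J)).
  by rewrite center_marker//; have : 0 < (side L)%:num by []; lra.
have e2 : `|center L - G (marker J)| <= 26 * `|center L - marker L|.
  have := ler_distD (center M) (center L) (G (center J)).
  have := ler_distD (G (center J)) (center L) (G (marker J)).
  by rewrite center_marker//; rewrite /image_size in JM; lra.
have := phiH _ _ _ e1; have := phiH _ _ _ e2; rewrite !GK -/r => h2 h1.
apply: Sex => //; last by rewrite distrC; lra.
have := ler_distD (phi (center L)) (center J) (marker J).
by rewrite center_marker// (distrC (center J)); lra.
Qed.

Lemma composition_geometry : exists2 B : R, 0 < B & forall Q,
  exists (P : cube R n -> cube R n) (S : cube R n -> set (cube R n))
    (M : cube R n -> cube R n -> cube R n),
  [/\ forall I, vol (pts (P I)) <= B * vol (phi @^-1` pts I),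
      forall L, S L `<=` dyadic Q,
      forall L (b : R), 0 <= b ->
        (\esum_(I in S L) b%:E <= (5 ^+ n * b)%:E)%E,
      forall L I, S L I ->
        vol ((phi \o psi) @^-1` pts I) <= B * vol (psi @^-1` pts L) &
      forall I J, dyadic Q J -> pts J `<=` pts I ->
        [/\ dyadic (P I) (M I J),
            vol (phi @^-1` pts J) <= B * vol (pts (M I J)),
            vol (psi @^-1` pts (M I J)) <= B * vol ((phi \o psi) @^-1` pts J) &
            forall L, pts (M I J) `<=` pts L ->
              exists2 I', S L I' & pts J `<=` pts I']].
Proof.
have size0 g I : 0 <= image_size g I by exact: normr_ge0.
have idV : sized (fun I => vol (pts I)) (image_size id).
  by apply: (@sized_preimage _ _ id id) => //; exact: three_point_id.
have phiV := sized_preimage n_gt0 phiK GK G3.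
have psiV := sized_preimage n_gt0 psiK KK K3.
have hV := sized_preimage n_gt0 (can_comp phiK psiK) (can_comp KK GK)
  (three_point_comp K3 G3).
have [C1 C1_gt0 cube_ex] := image_cube.
have [C2 C2_gt0 dyadic_size] := image_dyadic_size.
have [C3 C3_gt0 net_ex] := image_net.
have [B1 B1_gt0 B1P] := sized_le C1_gt0 (size0 id) (size0 G) idV phiV.
have [B2 B2_gt0 B2P] := sized_le C2_gt0 (size0 K) (size0 (K \o G)) psiV hV.
have [B3 B3_gt0 B3P] := sized_le C3_gt0 (size0 (K \o G)) (size0 K) hV psiV.
have [B4 B4_gt0 B4P] := sized_le (ltr0n R 4) (size0 G) (size0 id) phiV idV.
have weaken (b b' u u' : R) : u <= b * u' -> 0 <= u' -> b <= b' -> u <= b' * u'.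
  by move=> /le_trans h u'0 bb'; apply: h; rewrite ler_wpM2r.
have vol0 (E : set 'rV[R]_n) : 0 <= vol E.
  by rewrite fine_ge0//; exact: outer_measure_ge0.
exists (B1 + B2 + B3 + B4) => [|Q]; first by lra.
have [P PP] := choice cube_ex; have [S SP] := choice (net_ex Q).
(* The requirement is conditional so that [choice] yields a total function; other pairs get a dummy
   value. *)
have M_ex (IJ : cube R n * cube R n) : exists M, pts IJ.2 `<=` pts IJ.1 ->
    [/\ dyadic (P IJ.1) M,
    image_size G IJ.2 <= (side M)%:num < 2 * image_size G IJ.2 &
    `|center M - G (center IJ.2)| <= (side M)%:num / 2].
  have [JI|] := pselect (pts IJ.2 `<=` pts IJ.1); last by exists IJ.1.
  have [_ /(_ _ JI) cP /(_ _ JI) sP] := PP IJ.1.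
  by have [M MP] := image_dyadic cP sP; exists M.
have [M MP] := choice M_ex.
exists P, S, (fun I J => M (I, J)); split.
- move=> I; have [PI _ _] := PP I.
  by apply: (weaken B1) => //; [apply: B1P; rewrite PI|lra].
- by move=> L; have [] := SP L.
- by move=> L; have [] := SP L.
- move=> L I SI; have [_ _ /(_ _ SI) h _] := SP L.
  by apply: (weaken B3) => //; [exact: B3P|lra].
- move=> I J QJ JI; have [PM /andP[sM1 sM2] cM] := MP (I, J) JI; split=> //.
  + apply: (weaken B4) => //; [apply: B4P|lra].
    by move: sM1; rewrite [image_size id _]/image_size center_marker//=; lra.
  + by apply: (weaken B2) => //; [apply: B2P; exact: dyadic_size|lra].
  + by move=> L ML; have [_ _ _ h] := SP L; exact: h ML sM1 cM.
Qed.

End CompositionGeometry.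

(** * Chaining weight families on abstract trees *)

Section ChainedWeights.
Variables (R : realType) (T : choiceType) (D : T -> set T) (le : T -> T -> Prop).
Implicit Types (v a b h mu : T -> R) (I J L Q : T) (B C : R).

(** [v] and [a] will be the [beta]-th powers of the volumes of a cube and of its preimage. *)
Definition gauge_weights v a C Q := exists mu,
  [/\ forall I, D Q I -> 0 <= mu I,
      forall J, D Q J ->
        ((v J / a J)%:E <= \esum_(I in [set I | D Q I /\ le J I]) (mu I)%:E)%E &
      (\esum_(I in D Q) (mu I * a I)%:E <= (C * v Q)%:E)%E].

(* [mu I * nu I L] is carried to the elements of [S L]; [M I J] plays the role
   of [J] in the tree of [P I]. *)
Lemma gauge_weights_comp v a b h B C1 C2 N Q
    (P : T -> T) (S : T -> set T) (M : T -> T -> T) :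
    (forall I, 0 < v I) -> (forall I, 0 < a I) -> (forall I, 0 < b I) ->
    (forall I, 0 < h I) -> 0 < B -> 0 <= C1 -> 0 <= C2 -> 0 < N ->
    gauge_weights v a C1 Q -> (forall I, gauge_weights v b C2 (P I)) ->
    (forall I, v (P I) <= B * a I) -> (forall L, S L `<=` D Q) ->
    (forall L c, 0 <= c -> (\esum_(I in S L) c%:E <= (N * c)%:E)%E) ->
    (forall L I, S L I -> h I <= B * b L) ->
    (forall I J, D Q J -> le J I ->
      [/\ D (P I) (M I J), a J <= B * v (M I J), b (M I J) <= B * h J &
          forall L, le (M I J) L -> exists2 I', S L I' & le J I']) ->
  gauge_weights v h (B ^+ 4 * N * C1 * C2) Q.
Proof.
move=> v0 a0 b0 h0 B_gt0 C1_ge0 C2_ge0 N_gt0 [mu [mu0 mu1 muC]] psiC PV SQ.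
move=> Scard SV MP.
have [nu nuP] := choice psiC.
pose Ctot := N * B ^+ 2 * C1 * C2.
have nu0 I L : D Q I -> D (P I) L -> 0 <= nu I L.
  by move=> _; have [+ _ _] := nuP I; apply.
pose tr := transfer (D Q) (fun I => D (P I)) S mu nu.
have tr0 J : (0 <= tr J)%E by exact: transfer_ge0.
have tr_cost : (\esum_(J in D Q) ((h J)%:E * tr J) <= (Ctot * v Q)%:E)%E.
  have hB L J : S L J -> h J <= B * b L by exact: SV.
  have Bb0 J : 0 <= B * b J by rewrite mulr_ge0 ?(ltW B_gt0) ?(ltW (b0 _)).
  have N0 := ltW N_gt0.
  apply: le_trans (transfer_cost mu0 nu0 (fun J => ltW (h0 J)) N0 Bb0 hB Scard) _.
  rewrite /Ctot -!mulrA EFinM lee_pmul2l ?lte_fin//.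
  apply: (@le_trans _ _ (\esum_(I in D Q)
      ((B ^+ 2 * C2)%:E * (mu I * a I)%:E))%E).
    apply: le_esum => I QI; have [_ _ nuC] := nuP I.
    rewrite (@eq_esum _ _ _ _ (fun L => B%:E * (nu I L * b L)%:E)%E); last first.
      by move=> L _; rewrite -EFinM; apply: (congr1 EFin); ring.
    rewrite esumZl ?(ltW B_gt0)//; last first.
      by move=> L PL; rewrite lee_fin mulr_ge0 ?nu0 ?(ltW (b0 _)).
    apply: (@le_trans _ _ ((mu I)%:E * (B%:E * (C2 * v (P I))%:E))%E).
      by rewrite !lee_wpmul2l ?lee_fin ?mu0 ?(ltW B_gt0).
    rewrite -!EFinM lee_fin.
    rewrite [leRHS](_ : _ = mu I * (B * (C2 * (B * a I)))); last by ring.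
    by rewrite !ler_wpM2l ?mu0 ?(ltW B_gt0)//; auto.
  rewrite esumZl ?mulr_ge0 ?exprn_ge0 ?(ltW B_gt0)//; last first.
    by move=> I QI; rewrite lee_fin mulr_ge0 ?mu0 ?(ltW (a0 _)).
  apply: (@le_trans _ _ ((B ^+ 2 * C2)%:E * (C1 * v Q)%:E)%E).
    by rewrite lee_wpmul2l ?lee_fin ?mulr_ge0 ?exprn_ge0 ?(ltW B_gt0).
  by rewrite -EFinM lee_fin le_eqVlt; apply/orP; left; apply/eqP; ring.
(* Weights must be real numbers: an infinite [tr J] would make the cost infinite, as [h J > 0]. *)
have tr_fin J : D Q J -> tr J = (fine (tr J))%:E.
  move=> QJ; rewrite fineK// ge0_fin_numE//.
  have : ((h J)%:E * tr J <= (Ctot * v Q)%:E)%E.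
    apply: le_trans tr_cost; apply: esum_ge; exists [set J].
      by split=> // _ ->.
    by rewrite fsbig_set1.
  move: (tr0 J); case: (tr J) => [r _ _|_|]//; first exact: ltry.
  by rewrite gt0_muley ?lte_fin// leye_eq.
(* The factor [B ^+ 2] repays the two comparisons of [M I J] with [J] in the lower bound; with the
   [B ^+ 2] of [Ctot] it makes up [B ^+ 4]. *)
exists (fun J => B ^+ 2 * fine (tr J)); split=> [J QJ|J QJ|].
- by rewrite mulr_ge0 ?exprn_ge0 ?fine_ge0 ?(ltW B_gt0).
- set F := [set I | _ /\ _].
  have FQ : F `<=` D Q by move=> I [].
  rewrite (@eq_esum _ _ _ _ (fun I => (B ^+ 2)%:E * tr I)%E); last first.
    by move=> I /FQ QI; rewrite [in RHS]tr_fin.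
  rewrite esumZl ?exprn_ge0 ?(ltW B_gt0)//.
  pose U I := [set L | D (P I) L /\ le (M I J) L].
  have US I L : F I -> U I L -> F `&` S L !=set0.
    move=> [QI JI] [PL ML]; have [_ _ _ /(_ _ ML)[I' SI' JI']] := MP I J QJ JI.
    by exists I'; split=> //; split=> //; exact: SQ SI'.
  have UP I : F I -> U I `<=` D (P I) by move=> _ L [].
  apply: (@le_trans _ _ ((B ^+ 2)%:E * \esum_(I in F)
      ((mu I)%:E * \esum_(L in U I) (nu I L)%:E))%E); last first.
    rewrite lee_wpmul2l ?lee_fin ?exprn_ge0 ?(ltW B_gt0)//.
    exact: transfer_lower.
  (* The inner sum is at least [v (M I J) / b (M I J)], hence at least a quotient free of [I], whose
     factor [a J] cancels against [v J / a J]. *)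
  apply: (@le_trans _ _ ((B ^+ 2)%:E * \esum_(I in F)
      ((a J / (B ^+ 2 * h J))%:E * (mu I)%:E))%E); last first.
    rewrite lee_wpmul2l ?lee_fin ?exprn_ge0 ?(ltW B_gt0)//.
    apply: le_esum => I [QI JI]; have [PM aM bM _] := MP I J QJ JI.
    have [_ /(_ _ PM) nu1 _] := nuP I.
    rewrite muleC lee_wpmul2l ?lee_fin ?mu0//; apply: le_trans nu1.
    rewrite lee_fin ler_pdivrMr ?mulr_gt0 ?exprn_gt0// mulrAC ler_pdivlMr//.
    apply: (@le_trans _ _ (B * v (M I J) * (B * h J))).
      by rewrite ler_pM ?(ltW (a0 _)) ?(ltW (b0 _))//; auto.
    by rewrite le_eqVlt; apply/orP; left; apply/eqP; ring.
  rewrite esumZl ?divr_ge0 ?mulr_ge0 ?exprn_ge0 ?(ltW B_gt0) ?(ltW (a0 _)) ?(ltW (h0 _))//;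
    last by move=> I [QI _]; rewrite lee_fin mu0.
  apply: (@le_trans _ _ ((B ^+ 2)%:E * ((a J / (B ^+ 2 * h J))%:E *
      (v J / a J)%:E))%E).
    rewrite -!EFinM lee_fin le_eqVlt; apply/orP; left; apply/eqP.
    by field; rewrite !gt_eqF.
  rewrite !lee_wpmul2l ?lee_fin ?divr_ge0 ?mulr_ge0 ?exprn_ge0 ?(ltW B_gt0)
    ?(ltW (a0 _)) ?(ltW (h0 _))//.
  exact: mu1.
- rewrite (@eq_esum _ _ _ _ (fun J => (B ^+ 2)%:E * ((h J)%:E * tr J))%E); last first.
    move=> J QJ; rewrite [in RHS]tr_fin// -!EFinM; apply: (congr1 EFin).
    by ring.
  rewrite esumZl ?exprn_ge0 ?(ltW B_gt0)//; last first.
    by move=> J _; rewrite mule_ge0// lee_fin ltW.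
  rewrite (_ : _ * v Q = B ^+ 2 * (Ctot * v Q)); last by rewrite /Ctot; ring.
  by rewrite [leRHS]EFinM lee_wpmul2l ?lee_fin ?exprn_ge0 ?(ltW B_gt0).
Qed.

End ChainedWeights.

(** * The gauge in terms of chainable weights *)

Section Renormalization.
Variables (R : realType) (n : nat) (beta : R) (f : 'rV[R]_n -> 'rV[R]_n).
Implicit Types I J Q : cube R n.
Local Notation v I := (vol (pts I) `^ beta).
Local Notation a I := (vol (f @^-1` pts I) `^ beta).

Hypothesis vol_gt0 : forall I, 0 < vol (pts I).
Hypothesis vol_preim_gt0 : forall I, 0 < vol (f @^-1` pts I).

Lemma powR_div (x y : R) : 0 < x -> 0 < y -> (x / y) `^ beta = x `^ beta / y `^ beta.
Proof.
move=> x0 y0; have yb0 : 0 < y `^ beta by exact: powR_gt0.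
apply: (mulIf (lt0r_neq0 yb0)); rewrite -powRM ?divr_ge0 ?(ltW x0) ?(ltW y0)//.
by rewrite !divfK// lt0r_neq0.
Qed.

Lemma esum_le_scale (A : set (cube R n)) (mu w : cube R n -> R) (c k : R) :
    0 < k -> (forall I, A I -> 0 <= mu I * w I) ->
  (\esum_(I in A) (mu I * (w I / k))%:E <= c%:E)%E =
  (\esum_(I in A) (mu I * w I)%:E <= (c * k)%:E)%E.
Proof.
move=> k0 muw0.
have -> : (\esum_(I in A) (mu I * w I)%:E =
    k%:E * \esum_(I in A) (mu I * (w I / k))%:E)%E.
  rewrite -esumZl ?(ltW k0)//; last first.
    by move=> I /muw0 ?; rewrite lee_fin mulrA divr_ge0// ltW.
  apply: eq_esum => I _; rewrite -EFinM; apply: (congr1 EFin).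
  by field; rewrite gt_eqF.
by rewrite mulrC EFinM lee_pmul2l// lte_fin.
Qed.

(* The substitution [mu I = lambda I * v I / a I] puts the two conditions of
   the gauge in a form in which the weights of two maps can be chained. *)
Lemma gauge_finiteP : (gauge beta f < +oo)%E <->
  exists2 C : R, 0 <= C & forall Q,
    gauge_weights (@dyadic R n) (fun J I => pts J `<=` pts I)
      (fun I => v I) (fun I => a I) C Q.
Proof.
have v0 I : 0 < v I by exact: powR_gt0.
have a0 I : 0 < a I by exact: powR_gt0.
have adm (lambda mu : cube R n -> R) Q J : dyadic Q J ->
    (forall I, dyadic Q I -> 0 <= mu I) ->
    (forall I, dyadic Q I -> lambda I = mu I * a I / v I) ->
  (1 <= \esum_(I in [set I | dyadic Q I /\ pts J `<=` pts I])
    (lambda I * (vol (pts I) / vol (pts J) *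
      (vol (f @^-1` pts J) / vol (f @^-1` pts I))) `^ beta)%:E)%E =
  ((v J / a J)%:E <=
    \esum_(I in [set I | dyadic Q I /\ pts J `<=` pts I]) (mu I)%:E)%E.
  move=> QJ mu0 lmu.
  rewrite (@eq_esum _ _ _ _ (fun I => (a J / v J)%:E * (mu I)%:E))%E; last first.
    move=> I [QI _]; rewrite -EFinM lmu//; apply: (congr1 EFin).
    rewrite powRM ?divr_ge0 ?(ltW (vol_gt0 _)) ?(ltW (vol_preim_gt0 _))//.
    rewrite !powR_div//; have := (v0 I, v0 J, a0 I); move: (v I) (v J) (a I) (a J).
    by move=> x y z w [[x0 y0] z0]; field; rewrite !gt_eqF.
  rewrite esumZl; last 2 first.
  - by rewrite divr_ge0// ltW.
  - by move=> I [QI _]; rewrite lee_fin mu0.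
  rewrite -[X in (X <= _)%E](_ : (a J / v J)%:E * (v J / a J)%:E = 1)%E.
    by rewrite lee_pmul2l// lte_fin divr_gt0.
  have := (v0 J, a0 J); move: (v J) (a J) => x y [x0 y0].
  by rewrite -EFinM; apply: (congr1 EFin); field; rewrite !gt_eqF.
have cost (lambda mu : cube R n -> R) Q (C : R) :
    (forall I, dyadic Q I -> 0 <= mu I) ->
    (forall I, dyadic Q I -> lambda I = mu I * a I / v I) ->
  (\esum_(I in dyadic Q)
    (lambda I * (vol (pts I) / vol (pts Q)) `^ beta)%:E <= C%:E)%E =
  (\esum_(I in dyadic Q) (mu I * a I)%:E <= (C * v Q)%:E)%E.
  move=> mu0 lmu; rewrite -(@esum_le_scale _ mu)//; last first.
    by move=> I QI; rewrite mulr_ge0 ?mu0 ?(ltW (a0 _)).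
  congr (_ <= _)%E; apply: eq_esum => I QI.
  rewrite (lmu _ QI) (powR_div (vol_gt0 _) (vol_gt0 _)); apply: (congr1 EFin).
  have := (v0 I, v0 Q); move: (v I) (v Q) (a I) => x y z [x0 y0].
  by field; rewrite !gt_eqF.
split=> [fin|[C C0 muP]].
  (* [C] lies strictly above the gauge because the infimum in [gauge_at] need not be attained. *)
  have [C C0 fC] : exists2 C : R, 0 <= C & (gauge beta f < C%:E)%E.
    move: fin; case: gauge => [r||]// _; last by exists 0; rewrite ?ltNyr.
    exists (Num.max 0 (r + 1)); first by rewrite le_max lexx.
    by rewrite lte_fin lt_max ltrDl ltr01 orbT.
  exists C => // Q; have : (gauge_at beta f Q < C%:E)%E.
    by apply: le_lt_trans fC; apply: ereal_sup_ubound; exists Q.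
  move=> /ereal_inf_lt[_ [lambda [lambda0 lambda1] <-] /ltW lambdaC].
  pose mu I := lambda I * v I / a I.
  have mu0 I : dyadic Q I -> 0 <= mu I.
    by move=> QI; rewrite divr_ge0 ?mulr_ge0 ?lambda0 ?(ltW (v0 _)) ?(ltW (a0 _)).
  have lmu I : dyadic Q I -> lambda I = mu I * a I / v I.
    move=> QI; rewrite /mu; have := (v0 I, a0 I); move: (v I) (a I) => x y [x0 y0].
    by field; rewrite !gt_eqF.
  exists mu; split=> // [J QJ|]; first by rewrite -(adm lambda)// lambda1.
  by rewrite -(cost lambda).
apply: (@le_lt_trans _ _ C%:E); last exact: ltry.
apply: ge_ereal_sup => _ [Q _ <-]; have [mu [mu0 mu1 muC]] := muP Q.
pose lambda I := mu I * a I / v I.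
apply: (@le_trans _ _ (\esum_(I in dyadic Q)
    (lambda I * (vol (pts I) / vol (pts Q)) `^ beta)%:E)%E).
  apply: ereal_inf_lbound; exists lambda => //; split=> [I QI|J QJ].
    by rewrite divr_ge0 ?mulr_ge0 ?mu0 ?(ltW (v0 _)) ?(ltW (a0 _)).
  by rewrite (adm lambda mu)// mu1.
by rewrite (cost lambda mu).
Qed.

End Renormalization.

(** * Composition of quasisymmetric maps with finite gauge *)

Lemma gauge_comp (R : realType) (n : nat) (beta : R)
    (phi psi : 'rV[R]_n -> 'rV[R]_n) :
    (0 < n)%N -> 0 < beta -> quasisymmetric phi -> quasisymmetric psi ->
    (gauge beta phi < +oo)%E -> (gauge beta psi < +oo)%E ->
  (gauge beta (phi \o psi) < +oo)%E.
Proof.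
move=> n0 beta0 /(quasisymmetric_three_point n0)[G [phiK GK phi3 G3]].
move=> /(quasisymmetric_three_point n0)[K [psiK KK _ K3]].
have v_gt0 (I : cube R n) : 0 < vol (pts I).
  by apply: (@vol_preimage_gt0 _ _ id id) => //; exact: three_point_id.
have a_gt0 I := vol_preimage_gt0 I n0 phiK GK G3.
have b_gt0 I := vol_preimage_gt0 I n0 psiK KK K3.
have h_gt0 (I : cube R n) : 0 < vol ((phi \o psi) @^-1` pts I).
  exact: (vol_preimage_gt0 I n0 (can_comp phiK psiK) (can_comp KK GK)
    (three_point_comp K3 G3)).
move=> /(gauge_finiteP beta v_gt0 a_gt0)[C1 C1_ge0 phiC].
move=> /(gauge_finiteP beta v_gt0 b_gt0)[C2 C2_ge0 psiC].
apply/(gauge_finiteP beta v_gt0 h_gt0).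
have [B0 B0_gt0 geom] := composition_geometry n0 phiK GK psiK KK phi3 G3 K3.
pose v (I : cube R n) := vol (pts I) `^ beta.
pose a (I : cube R n) := vol (phi @^-1` pts I) `^ beta.
pose b (I : cube R n) := vol (psi @^-1` pts I) `^ beta.
pose h (I : cube R n) := vol ((phi \o psi) @^-1` pts I) `^ beta.
pose B := B0 `^ beta.
have v0 I : 0 < v I by exact: powR_gt0.
have a0 I : 0 < a I by exact: powR_gt0.
have b0 I : 0 < b I by exact: powR_gt0.
have h0 I : 0 < h I by exact: powR_gt0.
have B_gt0 : 0 < B by exact: powR_gt0.
(* Positivity of [beta] makes the power monotone, so the volume comparisons survive it. *)
have powB (x y : R) : 0 < x -> 0 < y -> x <= B0 * y -> x `^ beta <= B * y `^ beta.
  move=> x0 y0 xy; rewrite /B -powRM ?(ltW y0) ?(ltW B0_gt0)//.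
  by rewrite ge0_ler_powR ?nnegrE ?mulr_ge0 ?(ltW beta0) ?(ltW x0) ?(ltW y0) ?(ltW B0_gt0).
exists (B ^+ 4 * 5 ^+ n * C1 * C2) => [|Q].
  by rewrite !mulr_ge0 ?exprn_ge0 ?(ltW B_gt0).
have [P [S [M [PV SQ Scard SV MP]]]] := geom Q.
have N0 : 0 < 5 ^+ n :> R by exact: exprn_gt0.
have PV' I : v (P I) <= B * a I by exact: powB.
have SV' L I : S L I -> h I <= B * b L by move=> /SV; exact: powB.
apply: (@gauge_weights_comp _ _ _ _ v a b h B C1 C2 _ Q P S M v0 a0 b0 h0 B_gt0
  C1_ge0 C2_ge0 N0 (phiC Q) (fun I => psiC (P I)) PV' SQ Scard SV').
move=> I J QJ JI; have [PM aM bM SM] := MP I J QJ JI.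
by split; [exact: PM|exact: powB|exact: powB|exact: SM].
Qed.

Theorem corollary6p1 (R : realType) (n : nat) (beta : R)
    (phi psi : 'rV[R]_n -> 'rV[R]_n)
    (hbeta : ((2 <= n)%N /\ 1 - 2 / n%:R < beta < 1) \/
             (n = 1%N /\ 0 < beta < 1))
    (qs_phi : quasisymmetric phi) (qs_psi : quasisymmetric psi)
    (hJ : n = 1%N ->
      [/\ J_in_A_infty phi, J_in_A_infty psi,
          J_in_A_infty (pinv setT phi) & J_in_A_infty (pinv setT psi)])
    (gauge_phi : (gauge beta phi < +oo)%E)
    (gauge_psi : (gauge beta psi < +oo)%E) :
  (gauge beta (phi \o psi) < +oo)%E.
Proof.
case: hbeta => [[n2 /andP[beta_gt _]]|[n1 /andP[beta0 _]]].
  apply: gauge_comp => //; first exact: leq_trans n2.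
  apply: le_lt_trans beta_gt; rewrite subr_ge0 ler_pdivrMr ?mul1r ?ler_nat//.
  by rewrite ltr0n (leq_trans _ n2).
by apply: gauge_comp => //; rewrite n1.
Qed.
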